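(* Let ${\boldsymbol\pi}$ be a permuton and let $\{\sigma_n\}_{n\in\mathbb N}$ be a sequence of permutations with $|\sigma_n|\to\infty$ whose associated permutons ${\boldsymbol\pi}_{\sigma_n}$ converge weakly to ${\boldsymbol\pi}$. Assume that ${\boldsymbol\pi}(A)=0$ for every monotone set $A\subset[0,1]^2$. Then $\operatorname{LIS}(\sigma_n)/|\sigma_n|\to0$.
   Context: A permuton is a Borel probability measure on $[0,1]^2$ with both marginals equal to Lebesgue measure on $[0,1]$. For a permutation $\sigma$ of size $n$, ${\boldsymbol\pi}_\sigma$ is $n$ times Lebesgue measure on $\bigcup_{j=1}^n[\frac{j-1}{n},\frac jn]\times[\frac{\sigma(j)-1}{n},\frac{\sigma(j)}{n}]$. A set $A\subset[0,1]^2$ is monotone if $A\subset([0,t]\times[0,s])\cup([t,1]\times[s,1])$ for every $(t,s)\in A$. $\operatorname{LIS}(\sigma)$ is the maximal cardinality of a set of indices on which $\sigma$ is increasing. *)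

(* Defs.v *)
From HB Require Import structures.
From mathcomp Require Import all_boot all_order all_algebra all_fingroup.
From mathcomp Require Import all_classical all_reals all_analysis.
Set Implicit Arguments. Unset Strict Implicit. Unset Printing Implicit Defensive.
Import Order.TTheory GRing.Theory Num.Theory.
Import numFieldNormedType.Exports.
Local Open Scope classical_set_scope.
Local Open Scope ring_scope.

(* The world: MathComp + MathComp-Analysis.  Measures on [0,1]^2 are
   represented as measures on the (Borel) product measurable space R * R. *)

Definition R2 (R : realType) := (measurableTypeR R * measurableTypeR R)%type.

Definition unit_square (R : realType) : set (R2 R) := `[0, 1]%classic `*` `[0, 1]%classic.

Definition is_permuton (R : realType)
  (mu : {measure set (R2 R) -> \bar R}) : Prop :=
  (forall A : set (measurableTypeR R), measurable A ->
     mu (A `*` setT) = (@lebesgue_measure R) (A `&` `[0, 1]%classic)) /\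
  (forall A : set (measurableTypeR R), measurable A ->
     mu (setT `*` A) = (@lebesgue_measure R) (A `&` `[0, 1]%classic)).

(* the square [j/n,(j+1)/n] x [s(j)/n,(s(j)+1)/n] (0-based indices) *)
Definition perm_square (R : realType) (n : nat) (s : 'S_n) (j : 'I_n) : set (R2 R) :=
  `[(j%:R / n%:R), (j.+1%:R / n%:R)]%classic `*`
  `[((s j)%:R / n%:R), ((s j).+1%:R / n%:R)]%classic.

Definition perm_support (R : realType) (n : nat) (s : 'S_n) : set (R2 R) :=
  \big[setU/set0]_(j < n) @perm_square R n s j.

Lemma measurable_perm_support (R : realType) (n : nat) (s : 'S_n) :
  measurable (@perm_support R n s).
Proof.
rewrite /perm_support; apply: bigsetU_measurable => j _.
by apply: measurableX; exact: measurable_itv.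
Qed.

Definition leb2 (R : realType) := ((@lebesgue_measure R) \x (@lebesgue_measure R))%E.

Definition perm_permuton (R : realType) (n : nat) (s : 'S_n) :
    {measure set (R2 R) -> \bar R} :=
  mscale (n%:R)%:nng (mrestr (@leb2 R) (@measurable_perm_support R n s)).

Definition weak_cvg (R : realType)
  (mu_ : nat -> {measure set (R2 R) -> \bar R})
  (mu : {measure set (R2 R) -> \bar R}) : Prop :=
  forall f : (R * R)%type -> R,
    {within (@unit_square R : set (R * R)%type), continuous f} ->
    ((fun k => \int[mu_ k]_(x in @unit_square R) (f x)%:E) @ \oo -->
      \int[mu]_(x in @unit_square R) (f x)%:E)%E.

Definition monotone_set (R : realType) (A : set (R2 R)) : Prop :=
  A `<=` @unit_square R /\
  forall t s : R, A (t, s) ->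
    A `<=` (`[0, t]%classic `*` `[0, s]%classic) `|` (`[t, 1]%classic `*` `[s, 1]%classic).

Definition incr_on (n : nat) (s : 'S_n) (I : {set 'I_n}) : bool :=
  [forall i in I, forall j in I, (i < j)%N ==> (s i < s j)%N].

Definition LIS (n : nat) (s : 'S_n) : nat :=
  \max_(I : {set 'I_n} | incr_on s I) #|I|.

(* Main.v *)
Require Import Defs.
From HB Require Import structures.
From mathcomp Require Import all_boot all_order all_algebra all_fingroup.
From mathcomp Require Import all_classical all_reals all_analysis measurable_realfun.
From mathcomp Require Import ring lra.
Import Order.TTheory GRing.Theory Num.Theory.
Import numFieldNormedType.Exports.
Local Open Scope classical_set_scope.
Local Open Scope ring_scope.
Set Implicit Arguments. Unset Strict Implicit. Unset Printing Implicit Defensive.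

(* If LIS(sigma_k)/N_k >= e for infinitely many k, record at each dyadic scale
   2^-m the set of grid cells met by the points (i/N_k, sigma_k(i)/N_k) of a
   longest increasing subsequence.  A diagonal pigeonhole argument makes these
   cell sets S_m constant along infinitely many such k, compatibly across all
   scales.  Any two cells of S_m are comparable in the coordinatewise order, and
   the unions B_m of the cells of S_m, each enlarged by one cell on every side,
   decrease in m.  Testing weak convergence against continuous bumps squeezed
   between the point squares and B_m shows pi(B_m) >= e, hence pi(/\_m B_m) >= e.
   But /\_m B_m is a monotone set, so it is pi-null. *)

Definition infinitely_often (P : nat -> Prop) : Prop :=
  forall n, exists2 k, (n <= k)%N & P k.

Lemma sub_infinitely_often (P Q : nat -> Prop) :
  (forall k, P k -> Q k) -> infinitely_often P -> infinitely_often Q.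
Proof. by move=> PQ oftP n; have [k nk /PQ] := oftP n; exists k. Qed.

Lemma infinitely_often_pigeonhole (T : finType) (P : nat -> Prop) (F : nat -> T) :
  infinitely_often P -> exists t, infinitely_often (fun k => P k /\ F k = t).
Proof.
move=> oftP; apply: contrapT => /forallNP rare.
have /choice [bound boundP] t : exists n, forall k, (n <= k)%N -> ~ (P k /\ F k = t).
  have /existsNP [n rare_n] := rare t.
  by exists n => k nk Pk; apply: rare_n; exists k.
have [k nk Pk] := oftP (\max_t bound t).
by apply: (boundP (F k) k) => //; exact: leq_trans (leq_bigmax _) nk.
Qed.

Lemma infinitely_often_near (P Q : nat -> Prop) :
  infinitely_often P -> (\forall k \near \oo, Q k) ->
  infinitely_often (fun k => P k /\ Q k).
Proof.
move=> oftP [n0 _ Qn0] n; have [k nk Pk] := oftP (maxn n n0).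
exists k; first exact: leq_trans (leq_maxl _ _) nk.
by split => //; apply: Qn0; exact: leq_trans (leq_maxr _ _) nk.
Qed.

Section Diagonal.
Variables (T : nat -> finType) (F : forall m, nat -> T m).

Definition often_pred := {P : nat -> Prop | infinitely_often P}.

Definition refine_often m (P : often_pred) : often_pred :=
  let t := cid (infinitely_often_pigeonhole (F m) (svalP P)) in
  exist _ (fun k => sval P k /\ F m k = sval t) (svalP t).

Variable P0 : often_pred.

(* Successive refinements of [P0] on which [F 0], ..., [F m] are constant. *)
Fixpoint often_chain m : often_pred :=
  refine_often m (if m is m'.+1 then often_chain m' else P0).

Lemma often_chain_le j m k :
  (j <= m)%N -> sval (often_chain m) k -> sval (often_chain j) k.
Proof.
elim: m => [|m IH]; first by rewrite leqn0 => /eqP ->.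
by rewrite leq_eqVlt => /orP [/eqP -> // | /IH jm [/jm]].
Qed.

Lemma often_chain_P0 m k : sval (often_chain m) k -> sval P0 k.
Proof. by move/(often_chain_le (leq0n m)) => []. Qed.

Lemma often_chain_const m k k' :
  sval (often_chain m) k -> sval (often_chain m) k' -> F m k = F m k'.
Proof. by case: m => [|m] [_ ->] [_ ->]. Qed.

End Diagonal.

Lemma infinitely_often_diagonal (T : nat -> finType) (F : forall m, nat -> T m)
    (P : nat -> Prop) : infinitely_often P ->
  exists S : forall m, T m, forall m,
    infinitely_often (fun k => P k /\ forall j, (j <= m)%N -> F j k = S j).
Proof.
move=> oftP; pose chain := often_chain F (exist _ P oftP).
have /all_sig [k0 k0P] m : {k | sval (chain m) k}.
  by have /cid2 [k _ Pk] := svalP (chain m) 0%N; exists k.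
exists (fun m => F m (k0 m)) => m n; have [k nk Pk] := svalP (chain m) n.
exists k => //; split; first exact: often_chain_P0 Pk.
move=> j jm; apply: often_chain_const (k0P j).
exact: often_chain_le jm Pk.
Qed.

Lemma cvge_to_ge_infinitely_often (R : realFieldType) (u : nat -> \bar R)
    (l a : \bar R) :
  u @ \oo --> l -> infinitely_often (fun k => (a <= u k)%E) -> (a <= l)%E.
Proof.
move=> ul often_a.
have /choice [phi phiP] n : exists k, (n <= k)%N /\ (a <= u k)%E.
  by have [k] := often_a n; exists k.
have phi_oo : phi n @[n --> \oo] --> \oo.
  move=> A [n0 _ An0]; exists n0 => // n /= n0n.
  by apply: An0; exact: leq_trans n0n (phiP n).1.
apply: cvge_to_ge (cvg_comp _ _ phi_oo ul) _.
by apply: nearW => n; exact: (phiP n).2.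
Qed.

Lemma cvg0_of_not_infinitely_often_ge (R : realFieldType) (u : nat -> R) :
  (forall k, 0 <= u k) ->
  (forall e, 0 < e -> ~ infinitely_often (fun k => e <= u k)) -> u @ \oo --> 0.
Proof.
move=> u_ge0 rare; apply/cvgrPdist_lt => e e_gt0.
have /existsNP [n rare_n] := rare e e_gt0.
exists n => // k /= nk; rewrite sub0r normrN ger0_norm // ltNge.
by apply/negP => eu; apply: rare_n; exists k.
Qed.

Section LongestIncreasingSet.
Variables (n : nat) (s : 'S_n).

Lemma incr_on_set0 : incr_on s finset.set0.
Proof. by apply/forallP => i; rewrite inE. Qed.

Definition lis_set : {set 'I_n} :=
  [arg max_(I > finset.set0 | incr_on s I) #|I|].

Lemma lis_set_incr : incr_on s lis_set.
Proof. by rewrite /lis_set; case: arg_maxnP => //; exact: incr_on_set0. Qed.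

Lemma card_lis_set : #|lis_set| = LIS s.
Proof.
rewrite /lis_set; case: arg_maxnP => [|I incrI maxI]; first exact: incr_on_set0.
apply/eqP; rewrite eqn_leq (leq_bigmax_cond _ incrI) /=.
by apply/bigmax_leqP => J; exact: maxI.
Qed.

End LongestIncreasingSet.

Lemma incr_on_leq n (s : 'S_n) (I : {set 'I_n}) :
  incr_on s I -> {in I &, forall i j : 'I_n, (i <= j)%N -> (s i <= s j)%N}.
Proof.
move=> /forallP incrI i j Ii Ij; rewrite leq_eqVlt => /predU1P [/val_inj -> // | ij].
apply: ltnW; move: (incrI i) => /implyP /(_ Ii) /forallP /(_ j) /implyP /(_ Ij).
by move/implyP; apply.
Qed.

Lemma dyadic_cell_subproof m n (i : 'I_n) : ((2^m * i) %/ n < 2^m)%N.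
Proof.
have n_gt0 : (0 < n)%N by apply: leq_ltn_trans (ltn_ord i).
by rewrite ltn_divLR // ltn_pmul2l ?expn_gt0.
Qed.

Definition dyadic_cell m n (i : 'I_n) : 'I_(2^m) := Ordinal (dyadic_cell_subproof m i).

Lemma dyadic_cell_half m n (i : 'I_n) : (dyadic_cell m.+1 i %/ 2)%N = dyadic_cell m i.
Proof. by rewrite /= -divnMA expnS -mulnA [(n * 2)%N]mulnC divnMl. Qed.

Lemma leq_dyadic_cell m n (i j : 'I_n) :
  (i <= j)%N -> (dyadic_cell m i <= dyadic_cell m j)%N.
Proof. by move=> ij; apply: leq_div2r; rewrite leq_mul2l ij orbT. Qed.

Definition cells m n (s : 'S_n) (I : {set 'I_n}) : {set 'I_(2^m) * 'I_(2^m)} :=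
  [set (dyadic_cell m i, dyadic_cell m (s i)) | i in I].

Definition cell_comparable k (c c' : 'I_k * 'I_k) : bool :=
  ((c.1 <= c'.1)%N && (c.2 <= c'.2)%N) || ((c'.1 <= c.1)%N && (c'.2 <= c.2)%N).

Lemma cells_comparable m n (s : 'S_n) (I : {set 'I_n}) :
  incr_on s I -> {in cells m s I &, forall c c', cell_comparable c c'}.
Proof.
move=> /incr_on_leq sI _ _ /imsetP [i Ii ->] /imsetP [j Ij ->].
rewrite /cell_comparable /=.
have [ij | /ltnW ji] := leqP i j; [apply/orP; left | apply/orP; right];
  by rewrite !leq_dyadic_cell ?sI.
Qed.

Section Blocks.
Variable R : realType.

(* The dyadic cell (a, b) of level m enlarged by one cell on every side, so that
   it contains the support of [cell_bump m a b] below. *)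
Definition block m (a b : nat) : set (R2 R) :=
  `[(a%:R - 1) / (2^m)%:R, (a%:R + 2) / (2^m)%:R] `*`
  `[(b%:R - 1) / (2^m)%:R, (b%:R + 2) / (2^m)%:R].

Definition block_union m (S : {set 'I_(2^m) * 'I_(2^m)}) : set (R2 R) :=
  \big[setU/set0]_(c in S) block m c.1 c.2.

Lemma block_unionP m (S : {set 'I_(2^m) * 'I_(2^m)}) z :
  block_union S z <-> exists2 c, c \in S & block m c.1 c.2 z.
Proof. by rewrite /block_union -bigcup_pred; split => -[c]; exists c. Qed.

Lemma measurable_block_union m (S : {set 'I_(2^m) * 'I_(2^m)}) :
  measurable (block_union S).
Proof.
by apply: bigsetU_measurable => c _; apply: measurableX; exact: measurable_itv.
Qed.

Lemma pow2_gt0 m : 0 < (2^m)%:R :> R.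
Proof. by rewrite ltr0n expn_gt0. Qed.

Lemma block_bounds m a b z : block m a b z ->
  [/\ a%:R - 1 <= (2^m)%:R * z.1, (2^m)%:R * z.1 <= a%:R + 2,
      b%:R - 1 <= (2^m)%:R * z.2 & (2^m)%:R * z.2 <= b%:R + 2].
Proof.
have M_gt0 := pow2_gt0 m.
case: z => x y [] /=; rewrite !in_itv /= => /andP [x1 x2] /andP [y1 y2].
rewrite ler_pdivrMr // in x1; rewrite ler_pdivlMr // in x2.
rewrite ler_pdivrMr // in y1; rewrite ler_pdivlMr // in y2.
by split; rewrite mulrC.
Qed.

Lemma block_half m a b : block m.+1 a b `<=` block m (a %/ 2) (b %/ 2).
Proof.
have M_gt0 := pow2_gt0 m.
have half_bounds (x : nat) :
    2 * ((x %/ 2)%:R - 1) <= x%:R - 1 :> R /\ x%:R + 2 <= 2 * ((x %/ 2)%:R + 2) :> R.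
  have xE : x%:R = 2 * (x %/ 2)%:R + (x %% 2)%:R :> R.
    by rewrite {1}(divn_eq x 2) natrD natrM mulrC.
  have r1 : (x %% 2)%:R <= 1%:R :> R by rewrite ler_nat -ltnS ltn_pmod.
  have r0 : 0 <= (x %% 2)%:R :> R by [].
  by rewrite xE; split; lra.
move=> z /block_bounds []; rewrite expnS natrM -mulrA => x1 x2 y1 y2.
have [a1 a2] := half_bounds a; have [b1 b2] := half_bounds b.
by split; rewrite /= in_itv /= ler_pdivrMr // ler_pdivlMr // !(mulrC _ (2^m)%:R);
  apply/andP; split; lra.
Qed.

Lemma block_union_cells_succ m n (s : 'S_n) (I : {set 'I_n}) :
  block_union (cells m.+1 s I) `<=` block_union (cells m s I).
Proof.
move=> z /block_unionP [_ /imsetP [i Ii ->]] /block_half.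
rewrite /= (dyadic_cell_half m i) (dyadic_cell_half m (s i)) => zi.
apply/block_unionP; exists (dyadic_cell m i, dyadic_cell m (s i)) => //.
by apply/imsetP; exists i.
Qed.

Definition comparable_upto (d : R) (z z' : R * R) : Prop :=
  (z.1 <= z'.1 + d /\ z.2 <= z'.2 + d) \/ (z'.1 <= z.1 + d /\ z'.2 <= z.2 + d).

Lemma block_union_comparable m (S : {set 'I_(2^m) * 'I_(2^m)}) z z' :
  {in S &, forall c c', cell_comparable c c'} ->
  block_union S z -> block_union S z' -> comparable_upto (3 / (2^m)%:R) z z'.
Proof.
have M_gt0 := pow2_gt0 m.
move=> S_cmp /block_unionP [c cS /block_bounds [a1 a2 b1 b2]].
move=> /block_unionP [c' c'S /block_bounds [a1' a2' b1' b2']].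
have scale (x y : R) : (2^m)%:R * x <= (2^m)%:R * y + 3 -> x <= y + 3 / (2^m)%:R.
  move=> h; have -> : y + 3 / (2^m)%:R = ((2^m)%:R * y + 3) / (2^m)%:R.
    by field; rewrite gt_eqF.
  by rewrite ler_pdivlMr // mulrC.
by case/orP: (S_cmp c c' cS c'S) => /andP []; rewrite -!(ler_nat R) => h1 h2;
  [left | right]; split; apply: scale; lra.
Qed.

Lemma exists_div_pow2_lt (c e : R) :
  0 <= c -> 0 < e -> exists m, c / (2^m)%:R < e.
Proof.
move=> c_ge0 e_gt0; have ce_ge0 : 0 <= c / e by rewrite divr_ge0 // ltW.
exists (Num.Def.archi_bound (c / e)).
rewrite ltr_pdivrMr ?pow2_gt0 // mulrC -ltr_pdivrMr //.
apply: lt_le_trans (archi_boundP ce_ge0) _.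
by rewrite ler_nat ltnW // ltn_expl.
Qed.

Lemma comparable_upto_dyadic z z' :
  (forall m, comparable_upto (3 / (2^m)%:R) z z') -> comparable_upto 0 z z'.
Proof.
move=> cmp; rewrite /comparable_upto !addr0.
wlog x_le : z z' cmp / z.1 <= z'.1.
  move=> sym; case/orP: (le_total z.1 z'.1) => [|x_ge]; first exact: sym.
  have cmp' m : comparable_upto (3 / (2^m)%:R) z' z by case: (cmp m); [right | left].
  by case: (sym z' z cmp' x_ge); [right | left].
have [y_le | y_gt] := leP z.2 z'.2; first by left.
have [x_eq | x_neq] := eqVneq z.1 z'.1.
  by right; rewrite x_eq; split; [| exact: ltW].
have x_lt : z.1 < z'.1 by rewrite lt_neqAle x_neq.
pose d := Num.min (z'.1 - z.1) (z.2 - z'.2).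
have d_gt0 : 0 < d by rewrite lt_min !subr_gt0 x_lt.
have [dx dy] : d <= z'.1 - z.1 /\ d <= z.2 - z'.2 by split; rewrite ge_min lexx ?orbT.
have [m m_lt] := exists_div_pow2_lt (ler0n R 3) d_gt0.
by case: (cmp m) => -[h1 h2]; lra.
Qed.
End Blocks.

Lemma continuous_bigmax (R : realType) (T : topologicalType) (I : Type)
    (r : seq I) (P : pred I) (F : I -> T -> R) : (forall i, continuous (F i)) ->
  continuous (fun z => \big[Num.max/0]_(i <- r | P i) F i z).
Proof.
move=> F_cont; elim: r => [|i r IH].
  by under eq_fun do rewrite big_nil; exact: cst_continuous.
under eq_fun do rewrite big_cons; case: (P i) => // z.
apply: (@continuous_max R T (F i) (fun z => \big[Num.max/0]_(j <- r | P j) F j z)).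
  exact: F_cont.
exact: IH.
Qed.

Lemma measurable_bigmax (R : realType) d (T : measurableType d) (I : Type)
    (r : seq I) (P : pred I) (F : I -> T -> R) :
  (forall i, measurable_fun setT (F i)) ->
  measurable_fun setT (fun z => \big[Num.max/0]_(i <- r | P i) F i z).
Proof.
move=> F_meas; elim: r => [|i r IH].
  by under eq_fun do rewrite big_nil; exact: measurable_cst.
under eq_fun do rewrite big_cons; case: (P i) => //.
exact: (@measurable_maxr _ _ _ _ (F i) (fun z => \big[Num.max/0]_(j <- r | P j) F j z)).
Qed.

Section BumpFunctions.
Variable R : realType.

Definition bump (u : R) : R :=
  Num.max 0 (Num.min 1 (Num.min (2 * (u + 1)) (2 * (2 - u)))).

Lemma bump_ge0 u : 0 <= bump u.
Proof. by rewrite /bump le_max lexx. Qed.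

Lemma bump_le1 u : bump u <= 1.
Proof. by rewrite /bump ge_max ler01 ge_min lexx. Qed.

Lemma bump_neq0 u : bump u != 0 -> -1 <= u <= 2.
Proof.
apply: contraR; rewrite negb_and -!ltNge => u_out.
apply/eqP/max_idPl; rewrite !ge_min.
by case/orP: u_out => ?; apply/orP; right; apply/orP; [left | right]; lra.
Qed.

Lemma bump_eq1 u : -1/2 <= u <= 3/2 -> bump u = 1.
Proof.
move=> /andP [u1 u2]; apply/eqP; rewrite /bump eq_le bump_le1 le_max.
by rewrite !le_min lexx /=; apply/orP; right; apply/andP; split; lra.
Qed.

Lemma continuous_affine (a b : R) : continuous (fun u : R => a * u + b).
Proof.
move=> x; apply: continuousD; last exact: cst_continuous.
by apply: continuousM; [exact: cst_continuous | exact: cvg_id].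
Qed.

Lemma continuous_bump : continuous bump.
Proof.
move=> x; apply: (@continuous_max R R (cst 0)
  (fun u => Num.min 1 (Num.min (2 * (u + 1)) (2 * (2 - u))))).
  exact: cst_continuous.
apply: (@continuous_min R R (cst 1)); first exact: cst_continuous.
apply: continuous_min.
  have -> : (fun u : R => 2 * (u + 1)) = (fun u => 2 * u + 2).
    by apply: funext => u; rewrite mulrDr mulr1.
  exact: continuous_affine.
have -> : (fun u : R => 2 * (2 - u)) = (fun u => (-2) * u + 4).
  by apply: funext => u; lra.
exact: continuous_affine.
Qed.

(* For 2^(m+1) <= n an interval of length 1/n stays within half a dyadic cell of
   level m beyond the cell containing its left end, inside the plateau of [bump]. *)
Lemma bump_dyadic_cell m n (i : 'I_n) (x : R) : (2^m.+1 <= n)%N ->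
  i%:R / n%:R <= x < i.+1%:R / n%:R ->
  bump ((2^m)%:R * x - (dyadic_cell m i)%:R) = 1.
Proof.
move=> n_big /andP [x1 x2]; apply: bump_eq1.
have M_gt0 := pow2_gt0 R m.
have n_pos : (0 < n)%N by rewrite (leq_trans _ n_big) ?expn_gt0.
have n_gt0 : 0 < n%:R :> R by rewrite ltr0n.
rewrite /dyadic_cell /=; set a := ((2^m * i) %/ n)%N.
have a_le : a%:R * n%:R <= (2^m)%:R * i%:R :> R.
  by rewrite -!natrM ler_nat leq_trunc_div.
have a_gt : (2^m)%:R * i%:R < (a%:R + 1) * n%:R :> R.
  by rewrite natr1 -!natrM ltr_nat ltn_ceil.
have M_le : 2 * (2^m)%:R <= n%:R :> R by rewrite -natrM ler_nat -expnS.
set M := (2^m)%:R : R; set N := n%:R : R.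
rewrite ler_pdivrMr // in x1; rewrite -natr1 ltr_pdivlMr // in x2.
have p1 : M * i%:R <= M * (x * N) by rewrite ler_pM2l.
have p2 : M * (x * N) < M * (i%:R + 1) by rewrite ltr_pM2l.
apply/andP; split; nra.
Qed.

Definition coord_bump m (a : nat) (x : R) : R := bump ((2^m)%:R * x - a%:R).

Lemma continuous_coord_bump m a : continuous (coord_bump m a).
Proof.
move=> x; apply: (@continuous_comp _ _ _ (fun x : R => (2^m)%:R * x - a%:R) bump).
  exact: continuous_affine.
exact: continuous_bump.
Qed.

Definition cell_bump m (a b : nat) (z : R * R) : R :=
  Num.min (coord_bump m a z.1) (coord_bump m b z.2).

Definition cells_bump m (S : {set 'I_(2^m) * 'I_(2^m)}) (z : R * R) : R :=
  \big[Num.max/0]_(c in S) cell_bump m c.1 c.2 z.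

Lemma continuous_cell_bump m a b : continuous (cell_bump m a b).
Proof.
move=> z; apply: (@continuous_min R _ (coord_bump m a \o fst) (coord_bump m b \o snd)).
  by apply: continuous_comp; [exact: cvg_fst | exact: continuous_coord_bump].
by apply: continuous_comp; [exact: cvg_snd | exact: continuous_coord_bump].
Qed.

Lemma measurable_cell_bump m a b : measurable_fun [set: R2 R] (cell_bump m a b).
Proof.
have coord_meas k c := continuous_measurable_fun (@continuous_coord_bump k c).
exact: measurable_minr (measurableT_comp (coord_meas m a) measurable_fst)
  (measurableT_comp (coord_meas m b) measurable_snd).
Qed.

Lemma continuous_cells_bump m S : continuous (@cells_bump m S).
Proof. by apply: continuous_bigmax => c; exact: continuous_cell_bump. Qed.

Lemma measurable_cells_bump m S : measurable_fun [set: R2 R] (@cells_bump m S).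
Proof. by apply: measurable_bigmax => c; exact: measurable_cell_bump. Qed.

Lemma cell_bump_neq0 m a b z : cell_bump m a b z != 0 -> block m a b z.
Proof.
have M_gt0 := pow2_gt0 R m.
rewrite /cell_bump /coord_bump => /negP nz.
have [/bump_neq0 /andP [u1 u2] /bump_neq0 /andP [v1 v2]] :
    bump ((2^m)%:R * z.1 - a%:R) != 0 /\ bump ((2^m)%:R * z.2 - b%:R) != 0.
  by split; apply/negP => /eqP eq0; apply: nz; rewrite eq0; apply/eqP;
    [apply/min_idPl | apply/min_idPr]; exact: bump_ge0.
by split; rewrite /= in_itv /= ler_pdivrMr // ler_pdivlMr // !(mulrC _ (2^m)%:R);
  apply/andP; split; lra.
Qed.

Lemma cells_bump_bounds m S z :
  0 <= @cells_bump m S z <= \1_(block_union S) z.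
Proof.
apply: (big_ind (fun x => 0 <= x <= \1_(block_union S) z)).
- by rewrite lexx indicE ler0n.
- by move=> x y /andP [x0 x1] /andP [y0 y1]; rewrite le_max x0 ge_max x1 y1.
- move=> c cS; rewrite le_min !bump_ge0 /= indicE.
  have [/eqP -> // | /cell_bump_neq0 zc] := boolP (cell_bump m c.1 c.2 z == 0).
  have -> : z \in block_union S by rewrite in_setE; apply/block_unionP; exists c.
  by rewrite ge_min bump_le1.
Qed.

Lemma cell_bump_le_cells_bump m (S : {set 'I_(2^m) * 'I_(2^m)}) c z :
  c \in S -> cell_bump m c.1 c.2 z <= cells_bump S z.
Proof. by move=> cS; rewrite /cells_bump (bigD1 c) //= le_max lexx. Qed.
End BumpFunctions.

Section PermutonIntegrals.
Variable R : realType.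

Lemma measurable_unit_square : measurable (@unit_square R).
Proof. by apply: measurableX; exact: measurable_itv. Qed.

Lemma integral_cells_bump_le (mu : {measure set (R2 R) -> \bar R}) m
    (S : {set 'I_(2^m) * 'I_(2^m)}) :
  (\int[mu]_(z in @unit_square R) (cells_bump S z)%:E
    <= mu (block_union S `&` @unit_square R))%E.
Proof.
rewrite -(integral_indic mu measurable_unit_square (measurable_block_union S)).
apply: (ge0_le_integral mu measurable_unit_square).
- by move=> z _; rewrite lee_fin; case/andP: (cells_bump_bounds S z).
- by apply/measurable_EFinP; apply: measurable_funTS; exact: measurable_cells_bump.
- apply/measurable_EFinP; apply: measurable_funTS; apply: measurable_indic.
  exact: measurable_block_union.
- by move=> z _; rewrite lee_fin; case/andP: (cells_bump_bounds S z).
Qed.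

Lemma leb2_rect (a b c d : R) : a < b -> c < d ->
  @leb2 R (`[a, b[ `*` `[c, d[) = ((b - a) * (d - c))%:E.
Proof.
move=> ab cd; rewrite /leb2 product_measure1E; try exact: measurable_itv.
rewrite -[X in X = _]/(lebesgue_measure (`[a, b[ : set R)
  * lebesgue_measure (`[c, d[ : set R))%E.
by rewrite !lebesgue_measure_itv /= !lte_fin ab cd -!EFinB -EFinM.
Qed.

(* Half-open, so that distinct point squares are disjoint. *)
Definition point_square n (s : 'S_n) (i : 'I_n) : set (R2 R) :=
  `[i%:R / n%:R, i.+1%:R / n%:R[ `*` `[(s i)%:R / n%:R, (s i).+1%:R / n%:R[.

Lemma point_square_sub_perm_square n (s : 'S_n) i :
  point_square s i `<=` @perm_square R n s i.
Proof.
have closed (a b x : R) : x \in `[a, b[ -> x \in `[a, b].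
  by rewrite !in_itv /= => /andP [-> /ltW ->].
by move=> z [] /closed z1 /closed z2; split.
Qed.

Lemma point_square_sub_unit_square n (s : 'S_n) i :
  point_square s i `<=` @unit_square R.
Proof.
have n_gt0 : 0 < n%:R :> R by rewrite ltr0n (leq_ltn_trans _ (ltn_ord i)).
have unit (k : 'I_n) (x : R) : x \in `[k%:R / n%:R, k.+1%:R / n%:R[ -> x \in `[0, 1].
  rewrite !in_itv /= => /andP [k1 k2]; apply/andP; split.
    by apply: le_trans k1; rewrite divr_ge0.
  by apply/ltW/(lt_le_trans k2); rewrite ler_pdivrMr // mul1r ler_nat.
by move=> z [] /unit z1 /unit z2.
Qed.

Lemma trivIset_point_square n (s : 'S_n) : trivIset setT (@point_square n s).
Proof.
move=> i j _ _ [z [[/= zi _] [/= zj _]]].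
have n_gt0 : 0 < n%:R :> R by rewrite ltr0n (leq_ltn_trans _ (ltn_ord i)).
move: zi zj; rewrite !in_itv /= !ler_pdivrMr ?ltr_pdivlMr //.
move=> /andP [i1 i2] /andP [j1 j2].
have ij : (i <= j)%N by rewrite -ltnS -(ltr_nat R); exact: le_lt_trans i1 j2.
have ji : (j <= i)%N by rewrite -ltnS -(ltr_nat R); exact: le_lt_trans j1 i2.
by apply/val_inj/eqP; rewrite eqn_leq ij ji.
Qed.

Lemma measurable_point_square n (s : 'S_n) i : measurable (point_square s i).
Proof. by apply: measurableX; exact: measurable_itv. Qed.

Lemma leb2_point_square n (s : 'S_n) i :
  leb2 (point_square s i) = (n%:R^-1 * n%:R^-1)%:E.
Proof.
have n_gt0 : 0 < n%:R :> R by rewrite ltr0n (leq_ltn_trans _ (ltn_ord i)).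
have width k : k.+1%:R / n%:R - k%:R / n%:R = n%:R^-1 :> R.
  by rewrite -mulrBl -natrB // subSnn mul1r.
by rewrite leb2_rect ?width // ltr_pM2r ?invr_gt0 // ltr_nat.
Qed.

Lemma perm_permuton_point_squares n (s : 'S_n) (I : {set 'I_n}) :
  perm_permuton R s (\big[setU/set0]_(i in I) point_square s i) = (#|I|%:R / n%:R)%:E.
Proof.
rewrite /perm_permuton /= /mscale /= /mrestr /= setIidl; last first.
  move=> z; rewrite -bigcup_pred => -[i _ /point_square_sub_perm_square zi].
  by rewrite /perm_support -bigcup_pred; exists i.
rewrite measure_bigsetU_ord; last 2 first.
- exact: measurable_point_square.
- exact: trivIset_point_square.
rewrite (eq_bigr (fun=> (n%:R^-1 * n%:R^-1)%:E)); last first.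
  by move=> i _; exact: leb2_point_square.
rewrite sumEFin sumr_const -EFinM; congr EFin.
rewrite -mulr_natr; have [->|n_neq0] := eqVneq (n%:R : R) 0.
  by rewrite !(mul0r, mulr0, invr0).
by field.
Qed.

Lemma card_le_integral_cells_bump m n (s : 'S_n) (I : {set 'I_n}) :
  (2^m.+1 <= n)%N ->
  ((#|I|%:R / n%:R)%:E <=
    \int[perm_permuton R s]_(z in @unit_square R) (cells_bump (cells m s I) z)%:E)%E.
Proof.
move=> n_big; set U := \big[setU/set0]_(i in I) point_square s i.
have U_meas : measurable U.
  by apply: bigsetU_measurable => i _; exact: measurable_point_square.
have U_sq : U `<=` @unit_square R.
  by move=> z; rewrite /U -bigcup_pred => -[i _ /point_square_sub_unit_square].
rewrite -(perm_permuton_point_squares s I) -/U -(setIidl U_sq).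
rewrite -(integral_indic _ measurable_unit_square U_meas).
apply: (ge0_le_integral _ measurable_unit_square).
- by move=> z _; rewrite lee_fin indicE.
- by apply/measurable_EFinP; apply: measurable_funTS; exact: measurable_indic.
- by apply/measurable_EFinP; apply: measurable_funTS; exact: measurable_cells_bump.
move=> z _; rewrite lee_fin indicE.
have [zU | _] := boolP (z \in U).
  2: by case/andP: (cells_bump_bounds (cells m s I) z).
move: zU; rewrite in_setE /U -bigcup_pred => -[i /= Ii [zx zy]].
have cell_i : (dyadic_cell m i, dyadic_cell m (s i)) \in cells m s I.
  by apply/imsetP; exists i.
apply: le_trans (cell_bump_le_cells_bump z cell_i).
by rewrite /cell_bump /coord_bump /= !bump_dyadic_cell // minxx.
Qed.
End PermutonIntegrals.

Lemma permuton_lty (R : realType) (pi : {measure set (R2 R) -> \bar R})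
    (A : set (R2 R)) :
  is_permuton pi -> measurable A -> (pi A < +oo)%E.
Proof.
move=> [pi_marg _] A_meas; apply: (@le_lt_trans _ _ (pi (setT `*` setT))).
  by apply: le_measure; rewrite ?inE //; exact: measurableX.
by rewrite pi_marg // setTI lebesgue_measure_itv /= lte01 oppr0 adde0 ltry.
Qed.

Lemma measure_bigcap_ge d (T : measurableType d) (R : realType)
    (mu : {measure set T -> \bar R}) (G : nat -> set T) (a : \bar R) :
  (mu (G 0%N) < +oo)%E -> (forall m, measurable (G m)) ->
  (forall m, G m.+1 `<=` G m) -> (forall m, a <= mu (G m))%E ->
  (a <= mu (\bigcap_m G m))%E.
Proof.
move=> G0_fin G_meas G_decr a_le.
have G_nonincr : {homo G : i j / (i <= j)%N >-> (j <= i)%O}.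
  by apply/nonincreasing_seqP => m; apply/subsetPset.
have bigcap_meas : measurable (\bigcap_m G m).
  by apply: bigcap_measurable => // k _.
apply: cvge_to_ge (nonincreasing_cvg_mu G0_fin G_meas bigcap_meas G_nonincr) _.
exact: nearW.
Qed.

Lemma monotone_bigcap_block_union (R : realType)
    (S : forall m, {set 'I_(2^m) * 'I_(2^m)}) :
  (forall m, {in S m &, forall c c', cell_comparable c c'}) ->
  monotone_set (\bigcap_m (block_union (S m) `&` @unit_square R)).
Proof.
move=> S_cmp; split => [z /(_ 0%N I) [] // | t s ts z' z'C].
have := comparable_upto_dyadic
  (fun m => block_union_comparable (S_cmp m) (ts m I).1 (z'C m I).1).
have [] := (z'C 0%N I).2; rewrite /= !in_itv /= => /andP [x0 x1] /andP [y0 y1].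
rewrite /comparable_upto !addr0 /= => -[[t_le s_le] | [t_ge s_ge]]; [right | left];
  by split; apply/andP; split.
Qed.

Lemma permuton_block_union_ge (R : realType) (pi : {measure set (R2 R) -> \bar R})
    (N : nat -> nat) (sigma : forall k, 'S_(N k)) (I : forall k, {set 'I_(N k)})
    (e : R) m (S : {set 'I_(2^m) * 'I_(2^m)}) :
  ((fun k => (N k)%:R : R) @ \oo --> +oo) ->
  weak_cvg (fun k => perm_permuton R (sigma k)) pi ->
  infinitely_often (fun k =>
    e <= #|I k|%:R / (N k)%:R /\ cells m (sigma k) (I k) = S) ->
  (e%:E <= pi (block_union S `&` @unit_square R))%E.
Proof.
move=> N_oo pi_lim often_e; apply: le_trans (integral_cells_bump_le pi S).
have := pi_lim _ (continuous_subspaceT (@continuous_cells_bump R m S)).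
move/cvge_to_ge_infinitely_often; apply.
have N_big : \forall k \near \oo, (2^m.+1 <= N k)%N.
  by apply: filterS ((cvgryPge _).1 N_oo (2^m.+1)%:R) => k; rewrite ler_nat.
apply: sub_infinitely_often (infinitely_often_near often_e N_big).
move=> k [[e_le <-] N_k]; apply: le_trans (card_le_integral_cells_bump R _ _ N_k).
by rewrite lee_fin.
Qed.

Theorem proposition3p2 (R : realType)
  (pi : {measure set (R2 R) -> \bar R})
  (N : nat -> nat) (sigma : forall k : nat, 'S_(N k)) :
  is_permuton pi ->
  ((fun k => (N k)%:R : R) @ \oo --> +oo) ->
  weak_cvg (fun k => perm_permuton R (sigma k)) pi ->
  (forall A : set (R2 R), measurable A -> monotone_set A -> pi A = 0%E) ->
  (fun k => (LIS (sigma k))%:R / (N k)%:R : R) @ \oo --> 0.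
Proof.
move=> pi_permuton N_oo pi_lim pi_monotone.
apply: cvg0_of_not_infinitely_often_ge => [k | e e_gt0 often_e]; first exact: divr_ge0.
pose C m k := cells m (sigma k) (lis_set (sigma k)).
have [S often_S] := infinitely_often_diagonal C often_e.
have C_S m : exists k, forall j, (j <= m)%N -> C j k = S j.
  by have [k _ [_ CS]] := often_S m 0%N; exists k.
pose G m := block_union (S m) `&` @unit_square R.
have G_meas m : measurable (G m).
  by apply: measurableI; [exact: measurable_block_union | exact: measurable_unit_square].
have G_ge m : (e%:E <= pi (G m))%E.
  apply: (permuton_block_union_ge (I := fun k => lis_set (sigma k)) N_oo pi_lim).
  apply: sub_infinitely_often (often_S m) => k [e_le CS].
  by rewrite card_lis_set; split => //; exact: CS.
have G_decr m : G m.+1 `<=` G m.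
  have [k CS] := C_S m.+1; apply: setSI.
  by rewrite -(CS m.+1 (leqnn _)) -(CS m (leqnSn _)); exact: block_union_cells_succ.
have G_monotone : monotone_set (\bigcap_m G m).
  apply: monotone_bigcap_block_union => m; have [k CS] := C_S m.
  by rewrite -(CS m (leqnn _)); exact: cells_comparable (lis_set_incr _).
have := measure_bigcap_ge (permuton_lty pi_permuton (G_meas 0%N)) G_meas G_decr G_ge.
rewrite pi_monotone ?lee_fin ?leNgt ?e_gt0 //.
by apply: bigcap_measurable => // m _.
Qed.
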